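(* Let $\xi\sim\mathcal U(\frac12,1)$ be a uniformly distributed random variable. Then the randomized Runge–Kutta method with two stages and Butcher coefficients $$A=\begin{pmatrix}\xi&0\\1-2\xi&\xi\end{pmatrix},\quad b=\begin{pmatrix}\tfrac12\\\tfrac12\end{pmatrix},\quad c=\begin{pmatrix}\xi\\1-\xi\end{pmatrix}$$ is algebraically stable, and consequently B-stable and A-stable, with probability one. Furthermore, if $f$ satisfies the assumption (L) of the context, then there is a constant $C_1>0$, independent of $f$ apart from $\nu$, such that $$\|\Phi(t,h,\xi,v)-\Phi(t,h,\xi,\widehat v)\|^2\le\big(1+hC_1\max(0,\nu)\big)\|v-\widehat v\|^2$$ holds for all $h\in[0,h_{\max}]$, all $t\in[0,T-h]$ and all $v,\widehat v\in\mathbb R^d$.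
   Context: Let $d\in\mathbb N$, $T\in(0,\infty)$; $\langle\cdot,\cdot\rangle$, $\|\cdot\|$ denote the Euclidean inner product and norm on $\mathbb R^d$. A Runge–Kutta method with $s$ stages, coefficients $A=(a_{ij})\in\mathbb R^{s,s}$, $b,c\in\mathbb R^s$ and step size $h$ is $u^{n+1}=u^n+h\sum_ib_ik^i_{n+1}$, $k^i_{n+1}=f(t_n+c_ih,\,u^n+h\sum_ja_{ij}k^j_{n+1})$. Algebraically stable: $b_i\ge0$ for all $i$ and the matrix $\mathbf M$ with entries $b_ia_{ij}+b_ja_{ji}-b_ib_j$ is positive semi-definite. B-stable: whenever $f$ satisfies $\langle f(t,v)-f(t,w),v-w\rangle\le0$ for all $t,v,w$, then for every $h>0$ one has $\|u_1-\widehat u_1\|\le\|u_0-\widehat u_0\|$, where $u_1,\widehat u_1$ are the numerical approximations after one step starting from $u_0,\widehat u_0$. A-stable: the stability function $R(z)=1+zb^\top(I_s-zA)^{-1}(1,\dots,1)^\top$ satisfies $|R(z)|\le1$ for all $z\in\mathbb C$ with $\mathrm{Re}(z)\le0$. (L) $f:[0,T]\times\mathbb R^d\to\mathbb R^d$ satisfies: (a) for every $v$, $t\mapsto f(t,v)$ is measurable, and for almost every $t\in[0,T]$, $v\mapsto f(t,v)$ is continuous; (b) there is $\nu\in\mathbb R$ with $\langle f(t,v)-f(t,w),v-w\rangle\le\nu\|v-w\|^2$ for all $t\in[0,T]$, $v,w\in\mathbb R^d$; (c) for every $\kappa>0$ there is $M_\kappa>0$ with $\|f(t,v)\|\le M_\kappa$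 for all $t\in[0,T]$, $\|v\|\le\kappa$. $h_{\max}=\min\{\alpha,T\}$ for a fixed $\alpha\in(0,\nu^{-1})$ if $\nu>0$, and $h_{\max}=T$ if $\nu\le0$. $\Phi(t,h,x,v)=v+\frac h2(k^1+k^2)$, where $k^1,k^2\in\mathbb R^d$ are the solutions of $k^1=f(t+hx,v+hxk^1)$ and $k^2=f(t+h(1-x),v+h(1-2x)k^1+hxk^2)$. *)

(* Defs.v *)
From HB Require Import structures.
From mathcomp Require Import all_boot all_order all_algebra.
From mathcomp Require Import all_classical all_reals all_analysis.
From mathcomp Require Import complex.
Import Order.TTheory GRing.Theory Num.Theory.
Import numFieldNormedType.Exports.

Set Implicit Arguments.
Unset Strict Implicit.
Unset Printing Implicit Defensive.

Local Open Scope classical_set_scope.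
Local Open Scope ring_scope.

(* The canonical norm `|v| on 'rV[R]_d is the sup norm, hence the explicit
   Euclidean structure. *)
Definition dot (R : realType) (d : nat) (v w : 'rV[R]_d) : R :=
  \sum_(i < d) v 0 i * w 0 i.

Definition enorm (R : realType) (d : nat) (v : 'rV[R]_d) : R :=
  Num.sqrt (dot v v).

(* The method is a relation between u0 and u1: for an implicit method the
   stage equations need not be (uniquely) solvable. *)
Definition rk_step (R : realType) (s d : nat) (A : 'M[R]_s) (b c : 'cV[R]_s)
    (f : R -> 'rV[R]_d -> 'rV[R]_d) (t h : R) (u0 u1 : 'rV[R]_d) : Prop :=
  exists k : 'I_s -> 'rV[R]_d,
    (forall i, k i = f (t + c i 0 * h) (u0 + h *: \sum_(j < s) A i j *: k j))
    /\ u1 = u0 + h *: \sum_(i < s) b i 0 *: k i.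

Definition psd (R : realType) (s : nat) (M : 'M[R]_s) : Prop :=
  M^T = M /\ forall x : 'cV[R]_s, 0 <= (x^T *m M *m x) 0 0.

Definition algebraically_stable (R : realType) (s : nat)
    (A : 'M[R]_s) (b : 'cV[R]_s) : Prop :=
  (forall i, 0 <= b i 0) /\
  psd (\matrix_(i, j) (b i 0 * A i j + b j 0 * A j i - b i 0 * b j 0)).

Definition B_stable (R : realType) (d s : nat)
    (A : 'M[R]_s) (b c : 'cV[R]_s) : Prop :=
  forall f : R -> 'rV[R]_d -> 'rV[R]_d,
    (forall t v w, dot (f t v - f t w) (v - w) <= 0) ->
  forall t h : R, 0 < h ->
  forall u0 v0 u1 v1 : 'rV[R]_d,
    rk_step A b c f t h u0 u1 -> rk_step A b c f t h v0 v1 ->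
    enorm (u1 - v1) <= enorm (u0 - v0).

Definition resolvent_mx (R : realType) (s : nat)
    (A : 'M[R]_s) (z : R[i]) : 'M[R[i]]_s :=
  1%:M - z *: map_mx (real_complex R) A.

Definition stability_function (R : realType) (s : nat)
    (A : 'M[R]_s) (b : 'cV[R]_s) (z : R[i]) : R[i] :=
  1 + z * ((map_mx (real_complex R) b)^T *m invmx (resolvent_mx A z)
             *m const_mx 1 : 'M[R[i]]_1) 0 0.

(* [invmx] is a junk value on singular matrices: that the stability function
   is defined at z is required separately. *)
Definition A_stable (R : realType) (s : nat)
    (A : 'M[R]_s) (b : 'cV[R]_s) : Prop :=
  forall z : R[i], complex.Re z <= 0 ->
    resolvent_mx A z \in unitmx /\ `|stability_function A b z| <= 1.

(* Only the values of f on [0, T] x R^d matter.  Measurability of an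
   R^d-valued map is measurability of its coordinates. *)
Definition assumption_L (R : realType) (d : nat) (T nu : R)
    (f : R -> 'rV[R]_d -> 'rV[R]_d) : Prop :=
  [/\ forall (v : 'rV[R]_d) (i : 'I_d),
        measurable_fun `[0, T] (fun t : R => f t v 0 i),
      {ae @lebesgue_measure R, forall t : R, t \in `[0, T] ->
        continuous (f t)},
      forall t v w, t \in `[0, T] ->
        dot (f t v - f t w) (v - w) <= nu * enorm (v - w) ^+ 2
    & forall kappa : R, 0 < kappa -> exists2 M : R, 0 < M &
        forall t v, t \in `[0, T] -> enorm v <= kappa -> enorm (f t v) <= M].

Definition hmax (R : realType) (T nu alpha : R) : R :=
  if 0 < nu then Num.min alpha T else T.

Definition butcher_A (R : realType) (x : R) : 'M[R]_2 :=
  \matrix_(i, j) if i == 0 then (if j == 0 then x else 0)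
                 else (if j == 0 then 1 - 2 * x else x).

Definition butcher_b (R : realType) : 'cV[R]_2 := const_mx 2^-1.

Definition butcher_c (R : realType) (x : R) : 'cV[R]_2 :=
  \col_i if i == 0 then x else 1 - x.

Definition Phi_stages (R : realType) (d : nat)
    (f : R -> 'rV[R]_d -> 'rV[R]_d) (t h x : R) (v : 'rV[R]_d) :
    set ('rV[R]_d * 'rV[R]_d) :=
  [set k | k.1 = f (t + h * x) (v + (h * x) *: k.1) /\
           k.2 = f (t + h * (1 - x))
                   (v + (h * (1 - 2 * x)) *: k.1 + (h * x) *: k.2)].

(* Meaningful only where the stage equations are solvable. *)
Definition Phi (R : realType) (d : nat)
    (f : R -> 'rV[R]_d -> 'rV[R]_d) (t h x : R) (v : 'rV[R]_d) : 'rV[R]_d :=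
  let k := xget (0, 0) (Phi_stages f t h x v) in
  v + (h / 2) *: (k.1 + k.2).

(* Main.v *)
Require Import Defs.
From HB Require Import structures.
From mathcomp Require Import all_boot all_order all_algebra.
From mathcomp Require Import all_classical all_reals all_analysis.
From mathcomp Require Import complex ring lra.
Import Order.TTheory GRing.Theory Num.Theory.
Import numFieldNormedType.Exports.
Local Open Scope classical_set_scope.
Local Open Scope ring_scope.

(** Everything holds for every value x of xi in the closed interval [1/2, 1],
    which carries the whole uniform law, so the almost sure statements reduce
    to deterministic ones; only the continuity of f t for almost every t
    produces a further exceptional set.

    Stability.  For this method the matrix M is (x - 1/4) times the rank-one
    matrix with rows (1, -1) and (-1, 1), hence the method is algebraically
    stable.  The three stability properties then all come from one energy
    inequality [rk_energy], valid for any algebraically stable method: the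
    squared norm grows in one step by at most 2 h times the b-weighted sum of
    the inner products of the slopes k_i with the stage values Y_i.
     - B-stability: apply it to the difference of two solutions; these inner
       products are nonpositive.
     - A-stability: C is R^2, and the test equation u' = z u has
       <z Y, Y> = (Re z) |Y|^2.
     - Growth of Phi: on differences, <k_i, Y_i> <= max(0, nu) |Y_i|^2, and each
       implicit stage is bounded by its explicit part ([implicit_stage_le])
       with a factor q = 1 / (1 - alpha nu), or q = 1 if nu <= 0, which yields
       C1 = 11 q^4.

    Solvability of the stages.  With y = w + r k, the equation k = g (w + r k)
    says that the map y - w - r g y vanishes, and this map is continuous and
    strongly monotone.  Such a map has a zero ([strongly_monotone_zero]): by
    induction on the dimension, solve for the last coordinates as a function of
    the first one, which depends continuously on it by strong monotonicity, and
    conclude by the intermediate value theorem.  For h <> 0 the two stage times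
    are affine, nonconstant functions of xi, so a Lebesgue null set of bad times
    pulls back to a P-null set ([ae_affine], [ae_uniform]). *)

(** * The Euclidean inner product *)

Section dot_theory.
Context {R : realType} {d : nat}.
Implicit Types u v w : 'rV[R]_d.

Lemma dotC u v : dot u v = dot v u.
Proof. by apply: eq_bigr => i _; rewrite mulrC. Qed.

Lemma dotDl u v w : dot (u + v) w = dot u w + dot v w.
Proof. by rewrite -big_split; apply: eq_bigr => i _; rewrite mxE mulrDl. Qed.

Lemma dotZl a u v : dot (a *: u) v = a * dot u v.
Proof. by rewrite /dot big_distrr; apply: eq_bigr => i _; rewrite /= mxE mulrA. Qed.

Lemma dotNl u v : dot (- u) v = - dot u v.
Proof. by rewrite -scaleN1r dotZl mulN1r. Qed.

Lemma dotBl u v w : dot (u - v) w = dot u w - dot v w.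
Proof. by rewrite dotDl dotNl. Qed.

Lemma dotDr u v w : dot w (u + v) = dot w u + dot w v.
Proof. by rewrite ![dot w _]dotC dotDl. Qed.

Lemma dotZr a u v : dot v (a *: u) = a * dot v u.
Proof. by rewrite ![dot v _]dotC dotZl. Qed.

Lemma dotNr u v : dot v (- u) = - dot v u.
Proof. by rewrite ![dot v _]dotC dotNl. Qed.

Lemma dotBr u v w : dot w (u - v) = dot w u - dot w v.
Proof. by rewrite dotDr dotNr. Qed.

Lemma dot0l v : dot 0 v = 0.
Proof. by rewrite -(scale0r 0) dotZl mul0r. Qed.

Lemma dot_suml n (k : 'I_n -> 'rV[R]_d) (a : 'I_n -> R) v :
  dot (\sum_i a i *: k i) v = \sum_i a i * dot (k i) v.
Proof.
elim/big_ind2: _ => [|x x' y y' <- <-|i _]; first exact: dot0l.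
  by rewrite dotDl.
by rewrite dotZl.
Qed.

Lemma dot_ge0 v : 0 <= dot v v.
Proof. by apply: sumr_ge0 => i _; rewrite -expr2 sqr_ge0. Qed.

Lemma dot_eq0 v : dot v v = 0 -> v = 0.
Proof.
move=> /eqP; rewrite psumr_eq0 => [/allP v0|i _]; last by rewrite -expr2 sqr_ge0.
apply/rowP => i; have := v0 i (mem_index_enum i).
by rewrite -expr2 sqrf_eq0 mxE => /eqP.
Qed.

Lemma sqr_enorm v : enorm v ^+ 2 = dot v v.
Proof. by rewrite sqr_sqrtr ?dot_ge0. Qed.

Lemma le_enorm v w : (enorm v <= enorm w) = (dot v v <= dot w w).
Proof. by rewrite ler_sqrt ?dot_ge0. Qed.

(** Young's inequality stands in for Cauchy-Schwarz throughout: it stays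
    polynomial in the squared norms. *)
Lemma dot_young a u v : 0 < a -> 2 * dot u v <= a * dot u u + a^-1 * dot v v.
Proof.
move=> a0; have := dot_ge0 (a *: u - v).
rewrite dotBl !dotBr !dotZl !dotZr (dotC v u) => ge0.
rewrite -(ler_pM2l a0) mulrDr [a * (a^-1 * _)]mulrA divff ?gt_eqF// mul1r.
lra.
Qed.

Lemma dot_subr_le u v : dot (u - v) (u - v) <= 2 * dot u u + 2 * dot v v.
Proof.
by have := dot_ge0 (u + v); rewrite !(dotBl, dotBr, dotDl, dotDr) (dotC v u); lra.
Qed.

End dot_theory.

(** * Energy estimate for algebraically stable methods *)

Section energy.
Context {R : realType} {s d : nat}.
Implicit Types (A : 'M[R]_s) (b : 'cV[R]_s) (k : 'I_s -> 'rV[R]_d).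

(** The sum splits over the d coordinates into values of the quadratic form
    of M. *)
Lemma psd_dot_ge0 (M : 'M[R]_s) k : psd M ->
  0 <= \sum_i \sum_j M i j * dot (k i) (k j).
Proof.
move=> [_ M0].
suff -> : \sum_i \sum_j M i j * dot (k i) (k j) =
    \sum_(l < d) ((\col_i k i 0 l)^T *m M *m \col_i k i 0 l) 0 0.
  by apply: sumr_ge0 => l _; exact: M0.
have E l : ((\col_i k i 0 l)^T *m M *m \col_i k i 0 l) 0 0 =
    \sum_i \sum_j M i j * (k i 0 l * k j 0 l).
  rewrite mxE exchange_big; apply: eq_bigr => j _.
  rewrite mxE big_distrl; apply: eq_bigr => i _.
  by rewrite !mxE /=; ring.
under [RHS]eq_bigr do rewrite E.
rewrite [RHS]exchange_big; apply: eq_bigr => i _.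
rewrite [RHS]exchange_big; apply: eq_bigr => j _.
by rewrite big_distrr.
Qed.

(** Expanding the squared norm of u1 and substituting u0 = Y_i - h sum_j a_ij k_j
    in its linear term leaves exactly - h^2 sum_ij m_ij <k_i, k_j>, which the
    psd hypothesis makes nonpositive. *)
Lemma rk_energy A b h u0 k : algebraically_stable A b ->
  let u1 := u0 + h *: \sum_i b i 0 *: k i in
  dot u1 u1 <= dot u0 u0
    + 2 * h * \sum_i b i 0 * dot (k i) (u0 + h *: \sum_j A i j *: k j).
Proof.
move=> [_ Mpsd] /=.
have E1 : dot (\sum_i b i 0 *: k i) (\sum_i b i 0 *: k i) =
    \sum_i \sum_j b i 0 * b j 0 * dot (k i) (k j).
  rewrite dot_suml; apply: eq_bigr => i _.
  rewrite dotC dot_suml big_distrr; apply: eq_bigr => j _.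
  by rewrite /= (dotC (k j)); ring.
have E2 : \sum_i b i 0 * dot (k i) (u0 + h *: \sum_j A i j *: k j) =
    dot (\sum_i b i 0 *: k i) u0
      + h * \sum_i \sum_j b i 0 * A i j * dot (k i) (k j).
  rewrite dot_suml big_distrr -big_split; apply: eq_bigr => i _ /=.
  rewrite dotDr dotZr mulrDr [dot (k i) (\sum_j _)]dotC dot_suml; congr (_ + _).
  rewrite mulrCA; congr (_ * _); rewrite big_distrr; apply: eq_bigr => j _.
  by rewrite /= (dotC (k j)); ring.
have E3 : \sum_i \sum_j b j 0 * A j i * dot (k i) (k j) =
    \sum_i \sum_j b i 0 * A i j * dot (k i) (k j).
  rewrite exchange_big; apply: eq_bigr => i _; apply: eq_bigr => j _.
  by rewrite (dotC (k j)).
have E4 : \sum_i \sum_j (\matrix_(i, j) (b i 0 * A i j + b j 0 * A j i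
        - b i 0 * b j 0)) i j * dot (k i) (k j) =
    2 * \sum_i \sum_j b i 0 * A i j * dot (k i) (k j)
      - dot (\sum_i b i 0 *: k i) (\sum_i b i 0 *: k i).
  rewrite E1 mulr2n mulrDl !mul1r -{2}E3 -big_split -sumrB.
  apply: eq_bigr => i _ /=; rewrite -big_split -sumrB.
  by apply: eq_bigr => j _ /=; rewrite mxE; ring.
have := psd_dot_ge0 _ k Mpsd; rewrite E4 => M0.
rewrite dotDl !dotDr !dotZl !dotZr (dotC u0) E2.
have := mulr_ge0 (sqr_ge0 h) M0; lra.
Qed.

(** The energy estimate, applied to the difference of two numerical solutions:
    the stage terms are nonpositive because f is dissipative. *)
Lemma algebraically_stable_B_stable A b c :
  algebraically_stable A b -> B_stable d A b c.
Proof.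
move=> ABs f fdiss t h h0 u0 v0 u1 v1 [k [kE ->]] [l [lE ->]].
rewrite le_enorm.
have subE (a : 'I_s -> R) : \sum_i a i *: (k i - l i) =
    \sum_i a i *: k i - \sum_i a i *: l i.
  by rewrite -sumrB; apply: eq_bigr => i _; rewrite scalerBr.
have -> : u0 + h *: (\sum_i b i 0 *: k i) - (v0 + h *: \sum_i b i 0 *: l i) =
    u0 - v0 + h *: \sum_i b i 0 *: (k i - l i).
  by rewrite subE scalerBr opprD addrACA.
apply: le_trans (rk_energy A b h (u0 - v0) (fun i => k i - l i) ABs) _.
rewrite gerDl pmulr_rle0; last by rewrite mulr_gt0.
apply: sumr_le0 => i _; rewrite mulr_ge0_le0 ?(proj1 ABs)//.
have -> : u0 - v0 + h *: (\sum_j A i j *: (k j - l j)) =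
    u0 + h *: (\sum_j A i j *: k j) - (v0 + h *: \sum_j A i j *: l j).
  by rewrite subE scalerBr opprD addrACA.
by rewrite {1}kE {1}lE; exact: fdiss.
Qed.

End energy.

(** * Algebraic stability implies A-stability *)

Section A_stability.
Context {R : realType}.
Implicit Types z w : R[i].

Definition complex_row z : 'rV[R]_2 :=
  \row_j if j == 0 then complex.Re z else complex.Im z.

Lemma complex_rowD : {morph complex_row : z w / z + w}.
Proof.
by move=> [a b] [a' b']; apply/rowP => j; rewrite !mxE; case: ifP.
Qed.

Lemma complex_row0 : complex_row 0 = 0.
Proof. by apply/rowP => j; rewrite !mxE; case: ifP. Qed.

Lemma complex_rowZ (a : R) z : complex_row (a%:C%C * z) = a *: complex_row z.
Proof.
by case: z => b c; apply/rowP => j; rewrite !mxE; case: ifP => _ /=; ring.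
Qed.

Lemma dot_complex_row z : dot (complex_row z) (complex_row z) =
  complex.Re z ^+ 2 + complex.Im z ^+ 2.
Proof. by rewrite /dot !big_ord_recl big_ord0 !mxE /= addr0 !expr2. Qed.

Lemma dot_complex_rowM z w : dot (complex_row (z * w)) (complex_row w) =
  complex.Re z * dot (complex_row w) (complex_row w).
Proof.
case: z => a b; case: w => a' b'.
by rewrite /dot !big_ord_recl !big_ord0 !mxE /=; ring.
Qed.

Lemma norm_complex_row z : `|z| = (enorm (complex_row z))%:C%C.
Proof. by rewrite /enorm dot_complex_row normc_def. Qed.

(** The stability function at z is one step of size 1 from u0 = 1 for
    u' = z u.  The stage values are the entries of g = (I - z A)^-1 1, and the
    energy estimate is applied to this step with C read as R^2. *)
Lemma algebraically_stable_A_stable {s} (A : 'M[R]_s) (b : 'cV[R]_s) :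
  (forall z, complex.Re z <= 0 -> resolvent_mx A z \in unitmx) ->
  algebraically_stable A b -> A_stable A b.
Proof.
move=> res ABs z z0; split; first exact: res.
pose g := invmx (resolvent_mx A z) *m (const_mx 1 : 'cV_s).
have gE i : g i 0 = 1 + \sum_j (A i j)%:C%C * (z * g j 0).
  have /(congr1 (fun M : 'cV_s => M i 0)) : resolvent_mx A z *m g = const_mx 1.
    by rewrite mulKVmx// res.
  rewrite /resolvent_mx mulmxBl mul1mx -scalemxAl !mxE => /eqP.
  rewrite subr_eq => /eqP ->; congr (_ + _).
  rewrite big_distrr; apply: eq_bigr => j _; rewrite !mxE /=; ring.
have RE : stability_function A b z = 1 + \sum_i (b i 0)%:C%C * (z * g i 0).
  rewrite /stability_function -mulmxA -/g mxE; congr (_ + _).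
  rewrite big_distrr; apply: eq_bigr => j _; rewrite !mxE /=; ring.
have rowE (a : 'I_s -> R) :
    complex_row (1 + \sum_i (a i)%:C%C * (z * g i 0)) =
    complex_row 1 + 1 *: \sum_i a i *: complex_row (z * g i 0).
  rewrite complex_rowD scale1r (big_morph _ complex_rowD complex_row0).
  by congr (_ + _); apply: eq_bigr => i _; rewrite complex_rowZ.
have := rk_energy A b 1 (complex_row 1) (fun i => complex_row (z * g i 0)) ABs.
rewrite /= -rowE -RE => en.
rewrite norm_complex_row -[1]/(1%:C)%C lecR -[leRHS]sqrtr1 ler_sqrt//.
apply: le_trans en _.
rewrite dot_complex_row /= expr1n expr0n addr0 gerDl mulr1.
rewrite pmulr_rle0// sumr_le0// => i _.
rewrite mulr_ge0_le0 ?(proj1 ABs)// -rowE -gE dot_complex_rowM.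
by rewrite mulr_le0_ge0 ?dot_ge0.
Qed.

End A_stability.

(** * Zeros of strongly monotone maps *)

Section monotone.
Context {R : realType}.

Lemma cvg_dot (T : Type) (F : set_system T) (FF : Filter F) n
    (y : T -> 'rV[R]_n) l :
  (fun s => dot (y s - l) (y s - l)) @ F --> 0 -> y @ F --> l.
Proof.
move=> y0; apply/cvg_ballP => e e0.
have e20 : 0 < e ^+ 2 by rewrite exprn_gt0.
move/cvgrPdist_lt: y0 => /(_ _ e20); apply: filterS => s.
rewrite sub0r normrN ger0_norm ?dot_ge0// => ys.
split => // i j; rewrite /ball/= (ord1 i) distrC.
rewrite -(ltr_pXn2r (n := 2)) ?nnegrE ?(ltW e0)// real_normK ?num_real//.
apply: le_lt_trans ys; rewrite /dot (bigD1 j)//= !mxE -expr2 lerDl.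
by apply: sumr_ge0 => m _; rewrite -expr2 sqr_ge0.
Qed.

Lemma continuous_dot_sqr n : continuous (fun x : 'rV[R]_n => dot x x).
Proof.
apply: continuous_big => [|i _ x]; first exact: add_continuous.
have ci : continuous (fun v : 'rV[R]_n => v 0 i) by exact: coord_continuous.
exact: (cvgM (ci x) (ci x)).
Qed.

Lemma dot_row_mx m n (a c : 'rV[R]_m) (b e : 'rV[R]_n) :
  dot (row_mx a b) (row_mx c e) = dot a c + dot b e.
Proof.
rewrite /dot big_split_ord /=; congr (_ + _); apply: eq_bigr => i _.
  by rewrite !row_mxEl.
by rewrite !row_mxEr.
Qed.

Lemma dot_scalar (a b : R) : dot (a%:M : 'rV_1) b%:M = a * b.
Proof. by rewrite /dot big_ord1 !mxE. Qed.

Lemma cvg_row_mx (T : Type) (F : set_system T) (FF : Filter F) n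
    (a : T -> R) (y : T -> 'rV[R]_n) a0 y0 :
  a @ F --> a0 -> y @ F --> y0 ->
  (fun s => row_mx (a s)%:M (y s)) @ F --> row_mx a0%:M y0.
Proof.
move=> /cvg_ballP aa /cvg_ballP yy; apply/cvg_ballP => e e0.
near=> s; split => // i j.
have [_ ys] : ball y0 e (y s) by near: s; exact: yy.
have as_ : ball a0 e (a s) by near: s; exact: aa.
rewrite -(splitK j); case: (fintype.split j) => k /=.
  by rewrite !row_mxEl !mxE (ord1 i) (ord1 k) /= !mulr1n.
by rewrite !row_mxEr.
Unshelve. all: by end_near. Qed.

(** Induction on the dimension.  For a fixed first coordinate s, the remaining
    components of F form a strongly monotone map in the remaining coordinates,
    with zero y s.  Strong monotonicity makes y continuous, and
    g s = F_0 (s, y s) inherits strong monotonicity since the other components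
    of F vanish along the curve; hence g changes sign. *)
Lemma strongly_monotone_zero n (F : 'rV[R]_n -> 'rV[R]_n) (c : R) : 0 < c ->
  continuous F ->
  (forall x y, c * dot (x - y) (x - y) <= dot (F x - F y) (x - y)) ->
  exists x, F x = 0.
Proof.
move=> c0; elim: n F => [|n IHn]; first by move=> F _ _; exists 0; apply/rowP => -[].
rewrite -[n.+1]/(1 + n)%N => F Fc Fm.
pose p (s : R) (y : 'rV[R]_n) : 'rV[R]_(1 + n) := row_mx s%:M y.
have Fsplit x x' : dot (F x - F x') (x - x') =
   dot (lsubmx (F x) - lsubmx (F x')) (lsubmx x - lsubmx x') +
   dot (rsubmx (F x) - rsubmx (F x')) (rsubmx x - rsubmx x').
  rewrite -dot_row_mx; congr dot.
    by rewrite -{1}(hsubmxK (F x)) -{1}(hsubmxK (F x')) opp_row_mx add_row_mx.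
  by rewrite -{1}(hsubmxK x) -{1}(hsubmxK x') opp_row_mx add_row_mx.
have psplit s s' y y' : dot (p s y - p s' y') (p s y - p s' y') =
    (s - s') ^+ 2 + dot (y - y') (y - y').
  by rewrite opp_row_mx add_row_mx dot_row_mx -raddfB /= dot_scalar.
have pc s s' y y' : c * ((s - s') ^+ 2 + dot (y - y') (y - y')) <=
   (lsubmx (F (p s y)) 0 0 - lsubmx (F (p s' y')) 0 0) * (s - s') +
   dot (rsubmx (F (p s y)) - rsubmx (F (p s' y'))) (y - y').
  rewrite -psplit; apply: le_trans (Fm _ _) _; rewrite Fsplit.
  rewrite {1 2}/p !row_mxKl !row_mxKr lerD2r [leLHS]big_ord1 !mxE.
  by rewrite /= !mulr1n.
have pc2 s : continuous (p s).
  move=> y; apply: (@cvg_row_mx _ (nbhs y) _ _ (fun=> s) id); first exact: cvg_cst.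
  exact: cvg_id.
have pc1 y : continuous (p^~ y).
  move=> s; apply: (@cvg_row_mx _ (nbhs s) _ _ id (fun=> y)); first exact: cvg_id.
  exact: cvg_cst.
have Gz s : exists y, rsubmx (F (p s y)) = 0.
  apply: IHn => [y|y y'].
    apply: (@continuous_comp _ _ _ (F \o p s) rsubmx).
      exact: (continuous_comp (pc2 s y) (Fc _)).
    exact: continuous_rsubmx.
  by have := pc s s y y'; rewrite subrr expr0n/= add0r mulr0 add0r.
have [y yE] := choice Gz.
have Fr s0 : (fun s => F (p s (y s0))) @ s0 --> F (p s0 (y s0)).
  exact: (continuous_comp (pc1 (y s0) s0) (Fc _)).
(* Monotonicity at s between y s and y s0 gives
   |y s - y s0| <= c^-1 |F_rest (s, y s0)|, which tends to 0 as s -> s0. *)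
have yc : continuous y.
  move=> s0; apply: (@cvg_dot _ (nbhs s0)).
  pose r s := c^-1 ^+ 2 * dot (rsubmx (F (p s (y s0)))) (rsubmx (F (p s (y s0)))).
  have r0 : r @ s0 --> 0.
    rewrite -(mulr0 (c^-1 ^+ 2)); apply: cvgMr.
    rewrite -[X in _ --> X](dot0l (0 : 'rV[R]_n)) -(yE s0).
    apply: (@cvg_comp _ _ _ _ (fun x => dot x x)).
      apply: (@cvg_comp _ _ _ _ rsubmx _ _ _ (Fr s0)).
      exact: continuous_rsubmx.
    exact: continuous_dot_sqr.
  apply: (@squeeze_cvgr _ _ _ _ (fun=> 0) r) r0; last exact: cvg_cst.
  apply: nearW => s; rewrite dot_ge0 /=.
  have := pc s s (y s) (y s0).
  rewrite subrr expr0n/= add0r mulr0 add0r yE sub0r dotNl.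
  have := dot_young c^-1 (rsubmx (F (p s (y s0)))) (- (y s - y s0)).
  rewrite invr_gt0 invrK => /(_ c0).
  rewrite !dotNr !dotNl opprK => h1 h2.
  rewrite /r -(ler_pM2l c0) expr2 !mulrA divff ?gt_eqF// mul1r.
  lra.
pose g s := lsubmx (F (p s (y s))) 0 0.
have gc : continuous g.
  move=> s0; apply: (@cvg_comp _ _ _ (fun s => F (p s (y s)))
    (fun x => lsubmx x 0 0)).
    apply: (@continuous_comp _ _ _ (fun s => p s (y s)) F); last exact: Fc.
    apply: (@cvg_row_mx _ (nbhs s0) _ _ id y); [exact: cvg_id|exact: yc].
  apply: (@continuous_comp _ _ _ lsubmx (fun x => x 0 0)).
    exact: continuous_lsubmx.
  exact: coord_continuous.
have gm s s' : c * (s - s') ^+ 2 <= (g s - g s') * (s - s').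
  have := pc s s' (y s) (y s'); rewrite !yE subrr dot0l addr0.
  by apply: le_trans; rewrite ler_pM2l// lerDl dot_ge0.
(* The slope of g is at least c, so [-B, B] contains its sign change; the
   summand 1 makes B positive. *)
pose B := `|g 0| / c + 1.
have B0 : 0 < B by rewrite ltr_wpDl// divr_ge0// ltW.
have cB : `|g 0| <= c * B.
  by rewrite mulrDr mulrCA divff ?gt_eqF// !mulr1 lerDl ltW.
have gB : 0 <= g B.
  have := gm B 0; rewrite subr0 expr2 mulrA ler_pM2r//.
  by have := ler_norm (- g 0); rewrite normrN; lra.
have gNB : g (- B) <= 0.
  have := gm (- B) 0; rewrite subr0 sqrrN expr2 mulrA mulrN -mulNr ler_pM2r//.
  by have := ler_norm (g 0); lra.
have [|||s _ gs] := @IVT R g (- B) B 0.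
- by lra.
- by apply: continuous_subspaceT.
- by rewrite ge_min gNB le_max gB orbT.
exists (p s (y s)); rewrite -[LHS]hsubmxK yE.
suff -> : lsubmx (F (p s (y s))) = 0 by rewrite row_mx0.
by apply/matrixP => i j; rewrite !ord1 -/(g s) gs mxE.
Qed.

End monotone.

(** * One implicit stage *)

Section stages.
Context {R : realType} {d : nat}.
Implicit Types (g : 'rV[R]_d -> 'rV[R]_d) (v w k y : 'rV[R]_d).

(** Pairing y = w + r k with y gives (1 - r nu) |y|^2 <= <w, y>.  The factor q
    bounds (1 - r nu)^-1 uniformly in r. *)
Lemma implicit_stage_le (r nu q : R) w k : 0 <= r -> 0 < q ->
  1 <= (1 - r * nu) * q ->
  let y := w + r *: k in
  dot k y <= nu * dot y y -> dot y y <= q ^+ 2 * dot w w.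
Proof.
move=> r0 q0 rnuq y ky.
have yE : dot y y = dot w y + r * dot k y by rewrite {1}/y dotDl dotZl.
have wy : (1 - r * nu) * dot y y <= dot w y.
  by have := ler_wpM2l r0 ky; lra.
have := dot_young q w y q0; have y0 := dot_ge0 y.
have := ler_wpM2r (dot_ge0 y) rnuq; have := ler_wpM2l (ltW q0) wy.
move=> h1 h2 h3.
have : q * (2 * dot w y) <= q * (q * dot w w + q^-1 * dot y y).
  by rewrite ler_pM2l.
rewrite mulrDr [q * (q^-1 * _)]mulrA divff ?gt_eqF//; lra.
Qed.

(** In terms of y = w + r k the stage is a zero of y - w - r g y, which is
    strongly monotone with constant 1 - r nu.  Continuity is asked only when
    r <> 0 so that a zero step size is covered at every time, including those
    where f t is discontinuous. *)
Lemma implicit_stage_solvable (r nu : R) g w : 0 <= r -> r * nu < 1 ->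
  (r != 0 -> continuous g) ->
  (forall y y', dot (g y - g y') (y - y') <= nu * dot (y - y') (y - y')) ->
  exists! k, k = g (w + r *: k).
Proof.
move=> r0 rnu gc gm.
have [->|r_neq0] := eqVneq r 0.
  exists (g w); split; first by rewrite scale0r addr0.
  by move=> k; rewrite scale0r addr0.
have r_gt0 : 0 < r by rewrite lt_def r_neq0.
have c0 : 0 < 1 - r * nu by rewrite subr_gt0.
have [||y yE] := strongly_monotone_zero _ (fun y => y - w - r *: g y) _ c0.
- move=> y; exact: (cvgB (cvgB cvg_id (cvg_cst w))
    (cvgZ (cvg_cst r) (gc r_neq0 y))).
- move=> y y'.
  have -> : y - w - r *: g y - (y' - w - r *: g y') =
      (y - y') - r *: (g y - g y').
    by rewrite scalerBr; apply/rowP => i; rewrite !mxE; ring.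
  rewrite [in leRHS]dotBl dotZl.
  by have := ler_wpM2l r0 (gm y y'); lra.
have ywE : w + r *: g y = y.
  by move/eqP: yE; rewrite subr_eq0 subr_eq addrC => /eqP <-.
exists (g y); split; first by rewrite ywE.
move=> k kE; set y' := w + r *: k in kE.
have yy' : y - y' = r *: (g y - k).
  by rewrite -{1}ywE /y' scalerBr opprD addrACA subrr add0r.
suff -> : y = y' by [].
apply/subr0_eq/dot_eq0/eqP; rewrite eq_le dot_ge0 andbT.
have : dot (y - y') (y - y') <= r * (nu * dot (y - y') (y - y')).
  by rewrite {1}yy' dotZl ler_wpM2l//; have := gm y y'; rewrite -kE.
rewrite -(pmulr_rle0 _ c0); lra.
Qed.

End stages.


(** * The two-stage method *)

Section butcher.
Context {R : realType}.

Lemma butcher_algebraically_stable (x : R) : 4^-1 <= x ->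
  algebraically_stable (butcher_A x) (butcher_b R).
Proof.
move=> x4; split=> [i|]; first by rewrite mxE invr_ge0.
split.
  by apply/matrixP => i j; rewrite !mxE addrC; ring.
move=> y; rewrite mxE !big_ord_recl big_ord0 !mxE !big_ord_recl !big_ord0 !mxE /=.
set y0 := y ord0 0; set y1 := y (lift ord0 ord0) 0.
rewrite [leRHS](_ : _ = (x - 4^-1) * (y0 - y1) ^+ 2); last by field.
by rewrite mulr_ge0 ?sqr_ge0// subr_ge0.
Qed.

(** The matrix is triangular with both diagonal entries 1 - z x, whose real
    part is at least 1. *)
Lemma butcher_resolvent_unit (x : R) (z : R[i]) : 0 <= x -> complex.Re z <= 0 ->
  resolvent_mx (butcher_A x) z \in unitmx.
Proof.
move=> x0 z0; rewrite unitmxE unitfE det_trig; last first.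
  apply/is_trig_mxP => i j; case: i j => [[|[|//]] ?] [[|[|//]] ?] //= _.
  by rewrite !mxE /= mulr0 subr0.
suff h : 1 - z * x%:C%C != 0.
  by apply/prodf_neq0; case=> -[|[|//]] ? _; rewrite !mxE eqxx.
apply/eqP => /(congr1 (@complex.Re R)); case: z z0 => a b /= a0.
rewrite mulr0 subr0 => h.
by have := mulr_le0_ge0 a0 x0; lra.
Qed.

End butcher.

Section two_stage.
Context {R : realType} {d : nat}.
Implicit Types (v w k y : 'rV[R]_d).

(** The energy estimate bounds the growth by h m (|y1|^2 + |y2|^2), so it
    remains to bound the stage values by v.  Here q controls (1 - h m)^-1, and
    11 q^4 dominates the sum of |y1|^2 <= q^2 |v|^2 and |y2|^2 <= 10 q^4 |v|^2. *)
Lemma two_stage_growth (x h m q : R) v k1 k2 :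
  2^-1 <= x <= 1 -> 0 <= h -> 0 <= m -> 0 < q -> 1 <= (1 - h * m) * q ->
  let y1 := v + (h * x) *: k1 in
  let y2 := v + (h * (1 - 2 * x)) *: k1 + (h * x) *: k2 in
  let u := v + (h / 2) *: (k1 + k2) in
  dot k1 y1 <= m * dot y1 y1 -> dot k2 y2 <= m * dot y2 y2 ->
  dot u u <= (1 + h * (11 * q ^+ 4) * m) * dot v v.
Proof.
move=> /andP[x2 x1] h0 m0 q0 hmq y1 y2 u k1m k2m.
have x0 : 0 < x by lra.
have q1 : 1 <= q by have := mulr_ge0 (mulr_ge0 h0 m0) (ltW q0); lra.
have q21 : 1 <= q ^+ 2 by rewrite expr_ge1// ltW.
have hx0 : 0 <= h * x by rewrite mulr_ge0// ltW.
have hxmq : 1 <= (1 - h * x * m) * q.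
  apply: le_trans hmq _; rewrite ler_pM2r// lerD2l lerN2 mulrAC.
  by rewrite ler_piMr// mulr_ge0.
have y1v : dot y1 y1 <= q ^+ 2 * dot v v by exact: implicit_stage_le hxmq k1m.
pose w := v + (h * (1 - 2 * x)) *: k1.
(* The explicit part w of the second stage is the combination
   (1 + th) v - th y1 with th = (2 x - 1) / x.  It is the condition
   1/2 <= x <= 1 that puts th in [0, 1] and makes the bound independent of x
   and free of f. *)
have wv : dot w w <= 10 * q ^+ 2 * dot v v.
  have [th [th0 th1 thx]] : exists th, [/\ 0 <= th, th <= 1 & th * x = 2 * x - 1].
    exists ((2 * x - 1) / x); rewrite divfK ?gt_eqF//.
    by split=> //; [rewrite divr_ge0 ?(ltW x0)//|rewrite ler_pdivrMr//]; lra.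
  have -> : w = (1 + th) *: v - th *: y1.
    rewrite /w (_ : h * (1 - 2 * x) = - (th * (h * x))); last first.
      by rewrite mulrCA thx; ring.
    by apply/rowP => i; rewrite !mxE; ring.
  apply: le_trans (dot_subr_le _ _) _; rewrite !dotZl !dotZr !mulrA.
  have v0 := dot_ge0 v; have y10 := dot_ge0 y1.
  have a1 : 2 * (1 + th) * (1 + th) * dot v v <= 8 * dot v v.
    by rewrite ler_wpM2r//; nra.
  have a2 : 2 * th * th * dot y1 y1 <= 2 * dot y1 y1.
    by rewrite ler_wpM2r//; nra.
  have a3 : dot v v <= q ^+ 2 * dot v v by rewrite ler_peMl.
  lra.
have y2v : dot y2 y2 <= 10 * q ^+ 4 * dot v v.
  have -> : 10 * q ^+ 4 * dot v v = q ^+ 2 * (10 * q ^+ 2 * dot v v) by ring.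
  apply: le_trans (_ : _ <= q ^+ 2 * dot w w) _.
    exact: implicit_stage_le hxmq k2m.
  by rewrite ler_pM2l// exprn_gt0.
have x4 : 4^-1 <= x by lra.
have := rk_energy _ _ h v (fun i : 'I_2 => if i == 0 then k1 else k2)
  (butcher_algebraically_stable x x4).
rewrite /= !big_ord_recl !big_ord0 !mxE !addr0 /=.
have -> : v + h *: (2^-1 *: k1 + 2^-1 *: k2) = u.
  by rewrite /u -scalerDr scalerA.
have -> : v + h *: (x *: k1 + 0 *: k2) = y1 by rewrite scale0r addr0 scalerA.
have -> : v + h *: ((1 - 2 * x) *: k1 + x *: k2) = y2.
  by rewrite scalerDr !scalerA addrA.
move=> /le_trans; apply.
have q24 : q ^+ 2 * dot v v <= q ^+ 4 * dot v v.
  rewrite ler_wpM2r ?dot_ge0// (_ : q ^+ 4 = q ^+ 2 * q ^+ 2); last by ring.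
  by rewrite ler_peMl ?sqr_ge0.
have hm0 : 0 <= h * m by rewrite mulr_ge0.
have := ler_wpM2l h0 k1m; have := ler_wpM2l h0 k2m.
have : h * m * (dot y1 y1 + dot y2 y2) <= h * m * (11 * q ^+ 4 * dot v v).
  by rewrite ler_wpM2l//; lra.
lra.
Qed.

End two_stage.

Section Phi_stability.
Context {R : realType} {d : nat}.

(** Access to Phi without uniqueness of the stages: the selected pair is some
    solution. *)
Lemma PhiP (f : R -> 'rV[R]_d -> 'rV[R]_d) (t h x : R) v :
  (exists k, Phi_stages f t h x v k) ->
  exists2 k, Phi_stages f t h x v k &
    Phi f t h x v = v + (h / 2) *: (k.1 + k.2).
Proof.
by move=> ex; exists (xget (0, 0) (Phi_stages f t h x v)); first exact: xgetPex.
Qed.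

(** Differences of two runs satisfy the hypotheses of [two_stage_growth] with
    slopes given by the differences of the stages, whichever solutions Phi
    selects. *)
Lemma Phi_growth (f : R -> 'rV[R]_d -> 'rV[R]_d) (T m q t h x : R) v v' :
  (forall t v w, t \in `[0, T] ->
     dot (f t v - f t w) (v - w) <= m * dot (v - w) (v - w)) ->
  2^-1 <= x <= 1 -> 0 <= h -> t \in `[0, T - h] ->
  0 <= m -> 0 < q -> 1 <= (1 - h * m) * q ->
  (exists k, Phi_stages f t h x v k) ->
  (exists k, Phi_stages f t h x v' k) ->
  dot (Phi f t h x v - Phi f t h x v') (Phi f t h x v - Phi f t h x v')
    <= (1 + h * (11 * q ^+ 4) * m) * dot (v - v') (v - v').
Proof.
move=> fm x01 h0 tT m0 q0 hmq /PhiP[[k1 k2] /= [k1E k2E] ->].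
move=> /PhiP[[l1 l2] /= [l1E l2E] ->].
rewrite /= in k1E k2E l1E l2E.
have -> : v + (h / 2) *: (k1 + k2) - (v' + (h / 2) *: (l1 + l2)) =
    v - v' + (h / 2) *: ((k1 - l1) + (k2 - l2)).
  by apply/rowP => i; rewrite !mxE; ring.
apply: (two_stage_growth _ _ _ _ _ _ _ x01 h0 m0 q0 hmq).
- have -> : v - v' + (h * x) *: (k1 - l1) =
      (v + (h * x) *: k1) - (v' + (h * x) *: l1).
    by apply/rowP => i; rewrite !mxE; ring.
  rewrite {1}k1E {1}l1E; apply: fm.
  move: x01 tT; rewrite !in_itv/= => /andP[x2 x1] /andP[t0 tT]; nra.
- have -> : v - v' + (h * (1 - 2 * x)) *: (k1 - l1) + (h * x) *: (k2 - l2) =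
      (v + (h * (1 - 2 * x)) *: k1 + (h * x) *: k2) -
      (v' + (h * (1 - 2 * x)) *: l1 + (h * x) *: l2).
    by apply/rowP => i; rewrite !mxE; ring.
  rewrite {1}k2E {1}l2E; apply: fm.
  move: x01 tT; rewrite !in_itv/= => /andP[x2 x1] /andP[t0 tT]; nra.
Qed.

(** The stages are solved one after the other, the matrix of the method being
    lower triangular.  Both stage times stay in [t, t + h]. *)
Lemma Phi_stages_solvable (f : R -> 'rV[R]_d -> 'rV[R]_d) (T nu t h x : R) v :
  (forall t v w, t \in `[0, T] ->
     dot (f t v - f t w) (v - w) <= nu * dot (v - w) (v - w)) ->
  2^-1 <= x <= 1 -> 0 <= h -> t \in `[0, T - h] -> h * x * nu < 1 ->
  (h != 0 -> continuous (f (t + h * x))) ->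
  (h != 0 -> continuous (f (t + h * (1 - x)))) ->
  exists! k, Phi_stages f t h x v k.
Proof.
move=> fm /andP[x2 x1] h0 tT hxnu c1 c2.
have hx0 : 0 <= h * x by rewrite mulr_ge0//; lra.
have hneq0 : h * x != 0 -> h != 0 by rewrite mulf_eq0 negb_or => /andP[].
have [|k1 [k1E k1U]] :=
    implicit_stage_solvable _ _ (f (t + h * x)) v hx0 hxnu (c1 \o hneq0).
  move=> y y'; apply: fm.
  by move: tT; rewrite !in_itv/= => /andP[t0 tT]; nra.
have [|k2 [k2E k2U]] := implicit_stage_solvable _ _ (f (t + h * (1 - x)))
    (v + (h * (1 - 2 * x)) *: k1) hx0 hxnu (c2 \o hneq0).
  move=> y y'; apply: fm.
  by move: tT; rewrite !in_itv/= => /andP[t0 tT]; nra.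
exists (k1, k2); split=> // -[l1 l2] [/= l1E l2E].
have l1k1 := k1U _ l1E; rewrite -l1k1 in l2E.
by rewrite -l1k1 (k2U _ l2E).
Qed.

End Phi_stability.

(** * Null sets under affine maps and under a uniform variable *)

Section affine_null.
Context {R : realType}.
Local Notation mu := (@lebesgue_measure R).

(** Uniqueness of Lebesgue measure: both sides are measures in A that agree on
    half-open intervals. *)
Lemma lebesgue_measure_affine (a b : R) (A : set R) : a != 0 -> measurable A ->
  mu A = (`|a|%:E * mu ((fun x => b + a * x)%R @^-1` A))%E.
Proof.
move=> a0 mA.
pose f : measurableTypeR R -> measurableTypeR R := fun x => b + a * x.
have mf : measurable_fun setT f.
  by apply: measurable_realfun.measurable_funD => //; exact: mulrl_measurable.
pose nu : {measure set (measurableTypeR R) -> \bar R} :=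
  mscale (NngNum (normr_ge0 a)) (pushforward mu f).
rewrite -[RHS]/(nu mf A).
apply: (@lebesgue_measure_unique R (nu mf)) => // _ [[u v] _ <-].
rewrite -[RHS]/(`|a|%:E * mu (f @^-1` `]u, v]%classic))%E.
(* For a < 0 the preimage of ]u, v] is closed on the left, open on the right. *)
case: (ltrgt0P a) a0 => // a_sgn _.
  have -> : f @^-1` `]u, v]%classic = `](u - b) / a, (v - b) / a]%classic.
    apply/seteqP; split => x /=; rewrite !in_itv/= /f ltr_pdivrMr// ler_pdivlMr//;
    by rewrite ltrBlDl lerBrDl mulrC.
  rewrite !lebesgue_measure_itv/= !lte_fin ltr_pM2r ?invr_gt0// ltrD2r.
  case: ifP => _; last by rewrite mule0.
  by rewrite -!EFinD -EFinM; congr EFin; field; rewrite gt_eqF.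
have -> : f @^-1` `]u, v]%classic = `[(v - b) / a, (u - b) / a[%classic.
  apply/seteqP; split => x /=; rewrite !in_itv/= /f ltr_ndivlMr// ler_ndivrMr//;
  by rewrite ltrBlDl lerBrDl mulrC andbC.
rewrite !lebesgue_measure_itv/= !lte_fin ltr_nM2r ?invr_lt0// ltrD2r.
case: ifP => _; last by rewrite mule0.
by rewrite -!EFinD -EFinM; congr EFin; field; rewrite lt_eqF.
Qed.

Lemma ae_affine (a b : R) (Q : R -> Prop) : a != 0 ->
  {ae mu, forall t, Q t} -> {ae mu, forall x, Q (b + a * x)}.
Proof.
move=> a0 [N [mN N0 QN]].
exists ((fun x => b + a * x) @^-1` N); split.
- rewrite -[X in measurable X]setTI.
  by apply: measurable_realfun.measurable_funD => //; exact: mulrl_measurable.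
- move: N0; rewrite (lebesgue_measure_affine a b N a0 mN) => /eqP.
  by rewrite mule_eq0 eqe normr_eq0 (negPf a0) => /eqP.
- by move=> x /= nQ; apply: QN.
Qed.

End affine_null.

Section uniform.
Context {R : realType} {disp : measure_display} {Omega : measurableType disp}.
Context {P : probability Omega R} (xi : {RV P >-> R}) {a b : R} (ab : a < b).

Definition uniformly_distributed : Prop := forall U : set R, measurable U ->
  distribution P xi U = uniform_prob ab U.

Lemma ae_uniform (Q : R -> Prop) : uniformly_distributed ->
  {ae @lebesgue_measure R, forall x, Q x} -> {ae P, forall w, Q (xi w)}.
Proof.
move=> xi_uniform [N [mN N0 QN]]; exists (xi @^-1` N); split.
- by rewrite -[X in measurable X]setTI; exact: measurable_funPT.
- rewrite -[LHS]/(distribution P xi N) xi_uniform//.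
  have /null_content_dominatesP := dominates_uniform_prob ab; exact.
- by move=> w /= nQ; apply: QN.
Qed.

Lemma ae_uniform_itv : uniformly_distributed ->
  {ae P, forall w, xi w \in `[a, b]}.
Proof.
move=> xi_uniform; exists (xi @^-1` ~` `[a, b]%classic); split.
- rewrite -[X in measurable X]setTI; apply: measurable_funPT => //.
  exact: measurableC.
- rewrite -[LHS]/(distribution P xi _) xi_uniform; last exact: measurableC.
  rewrite /uniform_prob integral_uniform_pdf setICl.
  exact: integral_set0.
- by move=> w /=.
Qed.

End uniform.

(** * Proof of the proposition *)

Theorem proposition5p8 (R : realType) (d : nat) (d_gt0 : (0 < d)%N)
    (T : R) (T_gt0 : 0 < T)
    (disp : measure_display) (Omega : measurableType disp)
    (P : probability Omega R) (xi : {RV P >-> R})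
    (half_lt1 : 2^-1 < 1 :> R)
    (xi_uniform : forall U : set R, measurable U ->
       distribution P xi U = uniform_prob half_lt1 U) :
  {ae P, forall w,
     [/\ algebraically_stable (butcher_A (xi w)) (butcher_b R),
         B_stable d (butcher_A (xi w)) (butcher_b R) (butcher_c (xi w))
       & A_stable (butcher_A (xi w)) (butcher_b R)]}
  /\
  forall nu alpha : R, (0 < nu -> 0 < alpha < nu^-1) ->
  exists C1 : R, 0 < C1 /\
    forall f : R -> 'rV[R]_d -> 'rV[R]_d, assumption_L T nu f ->
      (* the stage equations defining Phi are almost surely uniquely solvable;
         the null set may depend on t and h, since f t is continuous only for
         almost every t *)
      (forall h t : R, h \in `[0, hmax T nu alpha] -> t \in `[0, T - h] ->
         {ae P, forall w, forall v : 'rV[R]_d,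
            exists! k, Phi_stages f t h (xi w) v k})
      /\
      {ae P, forall w, forall h t : R,
         h \in `[0, hmax T nu alpha] -> t \in `[0, T - h] ->
         forall v v' : 'rV[R]_d,
           (exists k, Phi_stages f t h (xi w) v k) ->
           (exists k, Phi_stages f t h (xi w) v' k) ->
           enorm (Phi f t h (xi w) v - Phi f t h (xi w) v') ^+ 2
           <= (1 + h * C1 * Num.max 0 nu) * enorm (v - v') ^+ 2}.
Proof.
have xi_itv : {ae P, forall w, 2^-1 <= xi w <= 1}.
  apply: filterS (ae_uniform_itv _ _ xi_uniform) => w.
  by rewrite in_itv.
split.
  apply: filterS xi_itv => w /andP[x2 x1].
  have ABs : algebraically_stable (butcher_A (xi w)) (butcher_b R).
    by apply: butcher_algebraically_stable; lra.
  split=> //; first exact: algebraically_stable_B_stable.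
  apply: algebraically_stable_A_stable ABs => z.
  by apply: butcher_resolvent_unit; lra.
move=> nu alpha nu_alpha.
pose q := if 0 < nu then (1 - alpha * nu)^-1 else 1.
have an1 : 0 < nu -> alpha * nu < 1.
  move=> nu0; have /andP[_] := nu_alpha nu0.
  by rewrite -(ltr_pM2r nu0) mulVf// gt_eqF.
have q0 : 0 < q.
  by rewrite /q; case: ifP => // /an1; rewrite invr_gt0 subr_gt0.
exists (11 * q ^+ 4); split; first by rewrite mulr_gt0// exprn_gt0.
move=> f [_ fc fm _].
have {}fm t v w : t \in `[0, T] ->
    dot (f t v - f t w) (v - w) <= nu * dot (v - w) (v - w).
  by move=> tT; rewrite -sqr_enorm; exact: fm.
have hnuE h : h \in `[0, hmax T nu alpha] ->
    0 <= h /\ (0 < nu -> h * nu <= alpha * nu).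
  rewrite in_itv/= /hmax => /andP[-> hm]; split=> // nu0.
  by move: hm; rewrite nu0 le_min => /andP[? _]; rewrite ler_pM2r.
split=> [h t /hnuE[h0 hnu] tT|].
  have [h_eq0|h_neq0] := eqVneq h 0.
    apply: filterS xi_itv => w x01 v.
    apply: (Phi_stages_solvable f T nu) => //; rewrite ?h_eq0 ?eqxx//.
    by rewrite !mul0r.
  have c1 := ae_uniform _ _ _ xi_uniform (ae_affine h t _ h_neq0 fc).
  (* The second stage time t + h (1 - x) is the affine map (t + h) + (- h) x. *)
  have hN : - h != 0 by rewrite oppr_eq0.
  have c2 := ae_uniform _ _ _ xi_uniform (ae_affine (- h) (t + h) _ hN fc).
  apply: filterS3 xi_itv c1 c2 => w x01 c1 c2 v.
  have {}c2 : t + h * (1 - xi w) \in `[0, T] ->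
      continuous (f (t + h * (1 - xi w))).
    by move: c2; rewrite (_ : t + h + _ = t + h * (1 - xi w)) //; ring.
  move/andP: (x01) => [x2 x1].
  apply: (Phi_stages_solvable f T nu) => //.
  - have [nu0|nu0] := ltP 0 nu.
      have := an1 nu0; have := hnu nu0.
      have : h * nu * xi w <= h * nu by rewrite ler_piMr// mulr_ge0// ltW.
      lra.
    apply: le_lt_trans ltr01; rewrite mulr_ge0_le0// mulr_ge0//; lra.
  - move=> _; apply: c1.
    by move: tT; rewrite !in_itv/= => /andP[t0 tT]; nra.
  - move=> _; apply: c2.
    by move: tT; rewrite !in_itv/= => /andP[t0 tT]; nra.
apply: filterS xi_itv => w x01 h t /hnuE[h0 hnu] tT v v' kv kv'.
(* Only the one-sided Lipschitz constant max(0, nu) enters the growth bound, so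
   the case nu <= 0 is the same estimate with constant 0 and q = 1. *)
rewrite !sqr_enorm; apply: (Phi_growth f T) => //.
- move=> s y y' sT; apply: le_trans (fm _ _ _ sT) _.
  by rewrite ler_wpM2r ?dot_ge0// le_max lexx orbT.
- by rewrite le_max lexx.
- rewrite /q; case: (ltP 0 nu) => nu0; last by rewrite mulr0 subr0 mul1r.
  rewrite ler_pdivlMr ?subr_gt0 ?an1// mul1r lerD2l lerN2; exact: hnu.
Qed.
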